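(* Let $\kappa\in[0,1]$ and $\epsilon>0$. There is no (possibly randomized) algorithm that, given value-oracle access to any monotone submodular function $f:2^V\to\mathbb{R}_{\ge0}$ with $f(\emptyset)=0$ and curvature $\kappa_f=\kappa$ on an $n$-element ground set $V$, makes a number of queries polynomial in $n$ and outputs (with high probability) a function $\hat f$ such that $\hat f(X)\le f(X)\le \gamma\,\hat f(X)$ for all $X\subseteq V$, where $\gamma=\frac{n^{1/2-\epsilon}}{1+(n^{1/2-\epsilon}-1)(1-\kappa)}$.
   Context: In the value-oracle model the algorithm accesses $f$ only through queries returning $f(S)$ for chosen $S\subseteq V$. For $S\subseteq V$, $j\notin S$, $f(j\mid S)=f(S\cup\{j\})-f(S)$, and the curvature is $\kappa_f = 1-\min_{j\in V}\frac{f(j\mid V\setminus\{j\})}{f(\{j\})}$ (with $f(\{j\})>0$ for all $j$).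
   Formalization: The case κ = 0 is excluded (κ ∈ (0,1] instead of [0,1]): there γ = 1 and f is modular, so n queries of singletons determine f exactly and the claimed impossibility fails. *)

(* Defs.v *)
From HB Require Import structures.
From mathcomp Require Import all_boot all_order all_algebra.
From mathcomp Require Import all_classical all_reals all_analysis.

Set Implicit Arguments.
Unset Strict Implicit.
Unset Printing Implicit Defensive.

Import Order.TTheory GRing.Theory Num.Theory.
Import numFieldNormedType.Exports.

Local Open Scope classical_set_scope.
Local Open Scope ring_scope.

Section SetFunctions.
Context {R : realType} {V : finType}.
Implicit Types f g : {set V} -> R.

Definition marginal f (j : V) (X : {set V}) : R := f (j |: X)%SET - f X.

Definition monotone_setfun f : Prop :=
  forall A B : {set V}, A \subset B -> f A <= f B.

Definition submodular f : Prop :=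
  forall A B : {set V}, f (A :|: B)%SET + f (A :&: B)%SET <= f A + f B.

(* [V] being finite, the infimum is the minimum as soon as [V] is nonempty. *)
Definition curvature f : R :=
  1 - inf (range (fun j : V => marginal f j [set~ j]%SET / f [set j]%SET)).

Definition curvature_class (kappa : R) f : Prop :=
  [/\ forall X, 0 <= f X, f finset.set0 = 0, monotone_setfun f, submodular f
    & (forall j : V, 0 < f [set j]%SET) /\ curvature f = kappa].

Definition approximates (gamma : R) f g : Prop :=
  forall X : {set V}, g X <= f X <= gamma * g X.

End SetFunctions.

(* A deterministic adaptive algorithm in the value-oracle model: the next query
   depends on the previous answers only, and the local computation between two
   queries is unrestricted. *)
Inductive query_tree (R : realType) (V : finType) : Type :=
| Output of {set V} -> R
| Query of {set V} & (R -> query_tree R V).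

Section Oracle.
Context {R : realType} {V : finType}.
Implicit Types (f : {set V} -> R) (t : query_tree R V).

Fixpoint run f t : {set V} -> R :=
  match t with
  | Output g => g
  | Query X next => run f (next (f X))
  end.

Fixpoint num_queries f t : nat :=
  match t with
  | Output _ => 0
  | Query X next => (num_queries f (next (f X))).+1
  end.

End Oracle.

(* The random seed lives in an arbitrary probability space; once it is drawn,
   the algorithm is deterministic.  The ground set of size [n] is ['I_n]. *)
Record randomized_algorithm (R : realType) := RandomizedAlgorithm {
  seed_display : measure_display;
  seed : measurableType seed_display;
  seed_law : probability seed R;
  strategy : forall n : nat, seed -> query_tree R 'I_n
}.

Arguments strategy {R} A n w : rename.

Section Guarantees.
Context {R : realType}.
Variables (kappa : R) (A : randomized_algorithm R).

Definition polynomially_many_queries : Prop :=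
  exists q : {poly nat}, forall (n : nat) (f : {set 'I_n} -> R) (w : seed A),
    curvature_class kappa f -> (num_queries f (strategy A n w) <= q.[n])%N.

(* With high probability means with probability 1 - o(1) as n tends to
   infinity, uniformly in [f].  The success event is not assumed measurable:
   its probability is bounded below through a measurable event [E] contained
   in it. *)
Definition approximates_whp (gamma : nat -> R) : Prop :=
  forall delta : R, 0 < delta -> \forall n \near \oo,
    forall f : {set 'I_n} -> R, curvature_class kappa f ->
    exists E : set (seed A),
      [/\ measurable E, ((1 - delta)%:E <= seed_law A E)%E
        & forall w, E w -> approximates (gamma n) f (run f (strategy A n w))].

End Guarantees.

(* The factor is only of interest for [kappa > 0]: at [kappa = 0] it is 1 and
   the functions of the class are modular, hence determined exactly by the [n]
   queries of the singletons. *)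
Definition approx_factor {R : realType} (kappa eps : R) (n : nat) : R :=
  let r := n%:R `^ (2^-1 - eps) in r / (1 + (r - 1) * (1 - kappa)).

(* Main.v *)
(* A function of the class, f_0(X) = kappa min(|X|, a) + (1 - kappa) |X|, is hidden
   among perturbations f_R, indexed by the sets R of size a, in which R has rank b
   instead of a.  A query Q separates f_R from f_0 only if |Q| < 2a and |Q :&: R| > b;
   for n = 4a^2 this concerns at most a fraction 2^-(b+1) of the sets R.  Hence a
   polynomial number of queries leaves, for most R, the same output on f_R and f_0,
   although f_0(R) / f_R(R) exceeds the approximation factor as soon as
   a / b > n^(1/2 - eps).  With (2m+2) eps >= 1, the choice n = (2(b+1))^(2m+2) makes
   sqrt n, a and n^(1/2 - 1/(2m+2)) = a / (b+1) natural numbers. *)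

Require Import Defs.
From HB Require Import structures.
From mathcomp Require Import all_boot all_order all_algebra.
From mathcomp Require Import all_classical all_reals all_analysis.
From mathcomp Require Import measurable_realfun zify ring lra.

Import Order.TTheory GRing.Theory Num.Theory.
Import numFieldNormedType.Exports.

Local Open Scope ring_scope.

(** * Binomial estimates, and polynomial against exponential growth *)

Section Counting.
Local Open Scope nat_scope.

Lemma card_draws_supset (T : finType) (A : {set T}) k : #|A| <= k ->
  #|[set B : {set T} | A \subset B & #|B| == k]%SET| = 'C(#|T| - #|A|, k - #|A|).
Proof.
move=> Ak; rewrite -(card_in_imset (f := fun B : {set T} => (B :\: A)%SET)).
  have -> : #|T| - #|A| = #|~: A|%SET by rewrite [RHS]cardsCs finset.setCK.
  rewrite -cards_draws.
  apply: eq_card => C; rewrite inE; apply/imsetP/andP.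
    case=> B; rewrite inE => /andP[AB /eqP Bk] ->.
    by rewrite finset.subsetDr cardsD (finset.setIidPr AB) Bk.
  case=> CA /eqP Ck; have dCA : [disjoint A & C].
    by rewrite disjoint_sym finset.disjoints_subset.
  exists (A :|: C)%SET.
    rewrite inE finset.subsetUl cardsU (disjoint_setI0 dCA) cards0 Ck; apply/eqP; lia.
  apply/setP=> x; rewrite !inE; move/fintype.subsetP: CA => /(_ x).
  by rewrite !inE; case: (x \in A); case: (x \in C) => //= ->.
move=> B C; rewrite !inE => /andP[AB _] /andP[AC _] BC.
by rewrite -(finset.setUidPr AB) -(finset.setUidPr AC) -[B](finset.setID _ A)
  -[C](finset.setID _ A) BC (finset.setIidPr AB) (finset.setIidPr AC).
Qed.

(* Union bound over the [b]-subsets of [Q]. *)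
Lemma card_draws_large_inter (T : finType) (Q : {set T}) a b : b <= a ->
  #|[set R : {set T} | #|R| == a & b <= #|Q :&: R|]%SET|
    <= 'C(#|Q|, b) * 'C(#|T| - b, a - b).
Proof.
move=> ba; pose S := [set A : {set T} | A \subset Q & #|A| == b]%SET.
have sub : [set R : {set T} | #|R| == a & b <= #|Q :&: R|]%SET \subset
    (\bigcup_(A in S) [set B : {set T} | A \subset B & #|B| == a])%SET.
  apply/fintype.subsetP => R; rewrite inE => /andP[Ra].
  rewrite -bin_gt0 -cards_draws => /card_gt0P[A].
  rewrite inE finset.subsetI => /andP[/andP[AQ AR] Ab].
  by apply/bigcupP; exists A; rewrite inE ?AQ ?AR.
apply: leq_trans (subset_leq_card sub) _.
rewrite -(cards_draws Q b) -/S -sum_nat_const.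
elim/big_rec2: _ => [|A k C AS Ck]; first by rewrite cards0.
apply: leq_trans (leq_card_setU _ _) (leq_add _ Ck).
by move: AS; rewrite inE => /andP[_ /eqP Ab]; rewrite card_draws_supset Ab.
Qed.

(** For each index [i < b] the factors satisfy [2 * ((2 * a - i) * (a - i)) <= 4 * a ^ 2 - i], so
    each index pays for one factor 2. *)
Lemma ffact_halving a b : b <= a ->
  2 ^ b * ((2 * a) ^_ b * a ^_ b) <= (4 * a ^ 2) ^_ b.
Proof.
elim: b => [|b IH] ba; first by rewrite !ffactn0.
rewrite !ffactnSr expnS.
have -> : 2 * 2 ^ b * ((2 * a) ^_ b * (2 * a - b) * (a ^_ b * (a - b))) =
  2 ^ b * ((2 * a) ^_ b * a ^_ b) * (2 * ((2 * a - b) * (a - b))) by lia.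
apply: leq_mul; first exact/IH/ltnW.
have [c ->] : exists c, a = b + c by exists (a - b); lia.
have -> : b + c - b = c by lia.
have -> : 2 * (b + c) - b = b + 2 * c by lia.
rewrite leq_subRL ?expnS; nia.
Qed.

(** Turns the union bound into a fraction: in a ground set of size [4 * a ^ 2], at most one in
    [2 ^ b] of the [a]-subsets meets a given set of size [2 * a] in [b] or more points. *)
Lemma bin_halving a b : b <= a ->
  2 ^ b * ('C(2 * a, b) * 'C(4 * a ^ 2 - b, a - b)) <= 'C(4 * a ^ 2, a).
Proof.
move=> ba; set n := 4 * a ^ 2.
have an : a <= n by rewrite /n; nia.
have n_gt0 : 0 < 'C(n, b) by rewrite bin_gt0 (leq_trans ba).
rewrite -(leq_pmul2l n_gt0).
(* Both sides count the pairs of a [b]-subset inside an [a]-subset of an [n]-set. *)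
have E : 'C(n, b) * 'C(n - b, a - b) = 'C(n, a) * 'C(a, b).
  have f0 : 0 < b`! * (a - b)`! * (n - a)`! by rewrite !muln_gt0 !fact_gt0.
  apply/eqP; rewrite -(eqn_pmul2r f0); apply/eqP.
  have e1 := bin_fact (leq_trans ba an).
  have e2 := bin_fact (leq_sub2r b an).
  have e3 := bin_fact an.
  have e4 := bin_fact ba.
  rewrite subnBA// subnK ?(leq_trans ba an)// in e2.
  transitivity n`!; first by rewrite -e1 -e2; lia.
  by rewrite -e3 -e4; lia.
have -> : 'C(n, b) * (2 ^ b * ('C(2 * a, b) * 'C(n - b, a - b))) =
  2 ^ b * ('C(2 * a, b) * 'C(a, b)) * 'C(n, a).
  transitivity (2 ^ b * 'C(2 * a, b) * ('C(n, b) * 'C(n - b, a - b))); first by lia.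
  by rewrite E; lia.
rewrite leq_mul2r; apply/orP; right.
have f0 : 0 < b`! * b`! by rewrite muln_gt0 fact_gt0.
rewrite -(leq_pmul2r f0).
have -> : 2 ^ b * ('C(2 * a, b) * 'C(a, b)) * (b`! * b`!) =
  2 ^ b * ((2 * a) ^_ b * a ^_ b) by rewrite -!bin_ffact; lia.
rewrite [leqRHS]mulnA bin_ffact (leq_trans (ffact_halving _ _ ba))//.
by rewrite leq_pmulr ?fact_gt0.
Qed.

Lemma poly_nat_monomial_bound (q : {poly nat}) :
  exists c d, forall n, 0 < n -> q.[n]%R <= c * n ^ d.
Proof.
elim/poly_ind: q => [|q k [c [d H]]].
  by exists 0, 0 => n n0; rewrite horner0.
exists (c + k), d.+1 => n n0; rewrite hornerMXaddC mulnDl.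
apply: leq_add; first by rewrite expnSr mulnA leq_mul2r H ?orbT.
by rewrite leq_pmulr// expn_gt0 n0.
Qed.

(** Passing to [b ^ k.+1] leaves a spare factor [b] to absorb the constant. This power is at most
    [D * 2 ^ b]: [b <= 2 * (b - k)] compares it with [b ^_ k.+1], and ['C(b, k.+1)] counts some of
    the [2 ^ b] subsets. *)
Lemma monomial_lt_exp2 c k :
  exists N, forall b, N <= b -> c * b ^ k < 2 ^ b.
Proof.
pose D := 2 ^ k.+1 * k.+1`!.
exists (c * D + 2 * k).+1 => b Nb.
have b2k : 2 * k <= b by lia.
have bk : b <= 2 * (b - k) by lia.
have H1 : b ^ k.+1 <= D * 2 ^ b.
  apply: (@leq_trans ((2 * (b - k)) ^ k.+1)); first by rewrite leq_exp2r.
  rewrite expnMn /D -mulnA leq_mul2l; apply/orP; right.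
  have H2 : (b - k) ^ k.+1 <= b ^_ k.+1.
    rewrite ffact_prod -{1}(card_ord k.+1) -prod_nat_const.
    by apply: leq_prod => i _; rewrite leq_sub2l// -ltnS.
  apply: leq_trans H2 _; rewrite -bin_ffact mulnC leq_mul2l; apply/orP; right.
  rewrite -[b in 'C(b, _)]card_ord -card_draws.
  rewrite -[b in 2 ^ b]card_ord -cardsT -card_powerset.
  by apply: subset_leq_card; apply/fintype.subsetP => A; rewrite powersetE finset.subsetT.
have b0 : 0 < b by lia.
rewrite -(ltn_pmul2r b0) -mulnA -expnSr.
apply: (@leq_ltn_trans (c * D * 2 ^ b)).
  by rewrite -mulnA leq_mul2l H1 orbT.
by rewrite mulnC ltn_pmul2l ?expn_gt0//; lia.
Qed.

(** For fixed [m] the ground set size [(2 * b) ^ (2 * m)] is polynomial in [b], hence so is the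
    query bound. *)
Lemma poly_expn_lt_exp2 (q : {poly nat}) m :
  exists N, forall b, N <= b -> 2 * q.[((2 * b) ^ (2 * m))%N]%R < 2 ^ b.
Proof.
have [c [d H]] := poly_nat_monomial_bound q.
have [N HN] := monomial_lt_exp2 (2 * (c * 2 ^ (2 * m * d))) (2 * m * d).
exists N.+1 => b Nb; apply: leq_ltn_trans (HN b (ltnW Nb)).
have -> : 2 * (c * 2 ^ (2 * m * d)) * b ^ (2 * m * d) = 2 * (c * ((2 * b) ^ (2 * m)) ^ d).
  by rewrite -expnM expnMn !mulnA.
rewrite leq_mul2l H//.
by rewrite expn_gt0 muln_gt0 (leq_trans _ Nb).
Qed.

End Counting.

(** * Truncated rank functions with a planted set *)

Section HardFunctions.
Context {V : finType}.
Implicit Types (R X Y Q : {set V}).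
Local Open Scope nat_scope.

(* The truncated rank function of Goemans et al. and Svitkina-Fleischer, in
   which the planted set [R] has rank [b] instead of [minn #|R| a]; for [R]
   empty it is [minn #|X| a]. *)
Definition planted_rank (a b : nat) R X : nat :=
  minn (#|X :\: R| + minn #|X :&: R| b) a.

Lemma planted_rank_set0 a b X : planted_rank a b finset.set0 X = minn #|X| a.
Proof.
by rewrite /planted_rank finset.setD0 finset.setI0 cards0 min0n addn0.
Qed.

Lemma planted_rank_mono a b R X Y : X \subset Y ->
  planted_rank a b R X <= planted_rank a b R Y.
Proof.
move=> XY; rewrite /planted_rank.
have := subset_leq_card (finset.setSI R XY).
have := subset_leq_card (finset.setSD R XY).
lia.
Qed.

(** Both [#|X :\: R|] and [#|X :&: R|] are modular and monotone in [X], and truncating a monotone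
    submodular function by a constant keeps it submodular. *)
Lemma planted_rank_submodular a b R X Y :
  planted_rank a b R (X :|: Y)%SET + planted_rank a b R (X :&: Y)%SET <=
  planted_rank a b R X + planted_rank a b R Y.
Proof.
rewrite /planted_rank.
have cD : #|(X :|: Y) :\: R|%SET + #|(X :&: Y) :\: R|%SET
    = #|X :\: R|%SET + #|Y :\: R|%SET.
  have -> : ((X :&: Y) :\: R = (X :\: R) :&: (Y :\: R))%SET.
    by apply/setP=> x; rewrite !inE; case: (x \in R); rewrite ?andbF.
  by rewrite finset.setDUl cardsUI.
have cI : #|(X :|: Y) :&: R|%SET + #|(X :&: Y) :&: R|%SET
    = #|X :&: R|%SET + #|Y :&: R|%SET.
  have -> : ((X :&: Y) :&: R = (X :&: R) :&: (Y :&: R))%SET.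
    by apply/setP=> x; rewrite !inE; case: (x \in R); rewrite ?andbT ?andbF.
  by rewrite finset.setIUl cardsUI.
have := subset_leq_card (finset.setSI R (finset.subsetIl X Y)).
have := subset_leq_card (finset.setSI R (finset.subsetIr X Y)).
have := subset_leq_card (finset.setSD R (finset.subsetIl X Y)).
have := subset_leq_card (finset.setSD R (finset.subsetIr X Y)).
lia.
Qed.

Lemma planted_rank_set1 a b R j : 0 < a -> 0 < b -> planted_rank a b R [set j]%SET = 1.
Proof.
move=> a0 b0; rewrite /planted_rank.
have := cardsID R [set j]%SET; rewrite cards1; lia.
Qed.

(** At least [a] elements of [X] lie outside [R], so the outer truncation hides [R]. *)
Lemma planted_rank_large a b R X : #|R| <= a -> 2 * a <= #|X| -> planted_rank a b R X = a.
Proof.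
move=> Ra aX; rewrite /planted_rank.
have := cardsID R X; have := subset_leq_card (finset.subsetIr X R); lia.
Qed.

Lemma planted_rank_planted a b R : #|R| = a -> b <= a -> planted_rank a b R R = b.
Proof.
by move=> Ra ba; rewrite /planted_rank finset.setDv cards0 finset.setIid Ra; lia.
Qed.

Lemma planted_rank_small_inter a b R X : #|X :&: R| <= b ->
  planted_rank a b R X = minn #|X| a.
Proof.
by move=> Rb; rewrite /planted_rank (minn_idPl Rb) addnC cardsID.
Qed.

End HardFunctions.

(** * Curvature of the hidden functions, and the gap between them *)

Section HardClass.
Context {K : realType} {V : finType} (kappa : K) (hkappa : 0 < kappa <= 1).
Implicit Types (R X Y Q : {set V}).

Definition planted (a b : nat) R X : K :=
  kappa * (planted_rank a b R X)%:R + (1 - kappa) * #|X|%:R.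

(** Since [2 * a < #|V|], the rank is already saturated on [[set~ j]]; the last marginal comes from
    the linear term alone and equals [1 - kappa], while singletons have value 1. *)
Lemma planted_class (a b : nat) R : (0 < a)%N -> (0 < b)%N -> (#|R| <= a)%N ->
  (2 * a < #|V|)%N -> curvature_class kappa (planted a b R).
Proof.
move=> a0 b0 Ra aV; have /andP[k0 k1] := hkappa.
have k1' : 0 <= 1 - kappa by rewrite subr_ge0.
have P1 j : planted a b R [set j]%SET = 1.
  by rewrite /planted planted_rank_set1// cards1; ring.
have marg j :
    marginal (planted a b R) j [set~ j]%SET / planted a b R [set j]%SET = 1 - kappa.
  rewrite P1 /marginal finset.setUCr /planted.
  have cT : #|[set: V]%SET| = #|[set~ j]%SET|.+1.
    by rewrite -(finset.setUCr [set j]%SET) cardsU1 !inE eqxx.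
  rewrite !planted_rank_large//; last 2 first.
  - by rewrite -ltnS -cT cardsT.
  - by rewrite cardsT ltnW.
  by rewrite divr1 cT -natr1; ring.
split.
- by move=> X; rewrite addr_ge0// mulr_ge0// ltW.
- by rewrite /planted /planted_rank finset.set0D finset.set0I !cards0 add0n !min0n; ring.
- move=> X Y XY; rewrite lerD//.
    by rewrite ler_wpM2l ?ler_nat ?planted_rank_mono// ltW.
  by rewrite ler_wpM2l ?ler_nat ?subset_leq_card.
- move=> X Y; rewrite /planted.
  have /(congr1 (fun n : nat => n%:R : K)) := cardsUI X Y.
  have := planted_rank_submodular a b R X Y; rewrite -(ler_nat K) !natrD => H E.
  by have := ler_wpM2l (ltW k0) H; nra.
split=> [j|]; first by rewrite P1.
have V0 : (0 < #|V|)%N by apply: leq_ltn_trans aV.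
have /card_gt0P[v _] := V0.
rewrite /curvature.
have -> : (range (fun j : V =>
    marginal (planted a b R) j [set~ j]%SET / planted a b R [set j]%SET)
   = [set 1 - kappa])%classic.
  by apply/seteqP; split=> [_ [j _ <-]|_ ->] /=; [exact: marg|exists v].
by rewrite inf1; ring.
Qed.

(* Queries of size at least [2 * a] never see the planted set. *)
Lemma planted_diff_count (a b : nat) Q : (b < a)%N ->
  (#|[set R : {set V} | (#|R| == a) &&
      (planted a b R Q != planted a b finset.set0 Q)]%SET|
    <= 'C(2 * a, b.+1) * 'C(#|V| - b.+1, a - b.+1))%N.
Proof.
move=> ba; have [aQ|Qa] := leqP (2 * a) #|Q|.
  apply: (@leq_trans 0%N) => //; rewrite leqn0 cards_eq0; apply/eqP/setP=> R.
  rewrite !inE; apply/negP => /andP[/eqP Ra].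
  by rewrite /planted !planted_rank_large ?eqxx ?cards0 ?Ra.
apply: (@leq_trans ('C(#|Q|, b.+1) * 'C(#|V| - b.+1, a - b.+1))%N); last first.
  by rewrite leq_mul2r leq_bin2l ?orbT// ltnW.
apply: leq_trans (card_draws_large_inter _ _ _ _ ba).
apply/subset_leq_card/fintype.subsetP=> R; rewrite !inE => /andP[-> /=].
rewrite ltnNge; apply: contra => QRb.
by rewrite /planted planted_rank_set0 planted_rank_small_inter.
Qed.

(** At [R] the two approximations give [a <= gamma * g R] and [g R <= kappa * b + (1 - kappa) * a].
    Clearing the denominator of [gamma] leaves [kappa * a <= r * kappa * b]. *)
Lemma planted_gap (a b : nat) (r : K) R (g : {set V} -> K) :
  #|R| = a -> (b <= a)%N -> 0 < r -> r * b%:R < a%:R ->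
  let gamma := r / (1 + (r - 1) * (1 - kappa)) in
  approximates gamma (planted a b finset.set0) g ->
  ~ approximates gamma (planted a b R) g.
Proof.
move=> Ra ba r0 rba gamma /(_ R) /andP[_ lo] /(_ R) /andP[hi _].
have /andP[k0 k1] := hkappa.
move: lo hi; rewrite /planted planted_rank_set0 planted_rank_planted// Ra minnn.
have d0 : 0 < 1 + (r - 1) * (1 - kappa) by nra.
rewrite /gamma mulrAC ler_pdivlMr// => lo hi.
have := ler_wpM2l (ltW r0) hi.
nra.
Qed.

End HardClass.

(** * Query paths and averaging over seeds *)

Section Algorithms.
Context {K : realType} {V : finType}.

(** While the answers agree, the run on [F i] follows the path of the run on [f0]. Different outputs
    require a disagreement at a query on that single path, and the bounds [M] add up along it. *)
Lemma run_diff_count (I : finType) (D : {set I}) (F : I -> {set V} -> K)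
    (f0 : {set V} -> K) (M : nat) (t : query_tree K V) :
  (forall Q, (#|[set i in D | F i Q != f0 Q]%SET| <= M)%N) ->
  (#|[set i in D | `[< run (F i) t <> run f0 t >]]%SET| <= num_queries f0 t * M)%N.
Proof.
move=> FM; elim: t => [g|Q next IH] /=.
  rewrite mul0n leqn0 cards_eq0; apply/eqP/setP => i; rewrite !inE.
  by apply/negP => /andP[_ /asboolP].
rewrite mulSn; apply: leq_trans (leq_add (FM Q) (IH (f0 Q))).
apply: leq_trans (leq_card_setU _ _).
apply/subset_leq_card/fintype.subsetP => i; rewrite !inE => /andP[-> /asboolP H] /=.
by case: eqP => //= E; apply/asboolP; rewrite -E in H *.
Qed.

(** Double counting: the sum of the indicators is integrated once termwise and once through its
    pointwise bound. *)
Lemma expected_count_le (d : measure_display) (T : measurableType d)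
    (P : probability T K)
    (I : finType) (D : {set I}) (E : I -> set T) (p : K) (c : nat) :
  (forall i, i \in D -> measurable (E i)) ->
  (forall i, i \in D -> (p%:E <= P (E i))%E) ->
  (forall w, (#|[set i in D | w \in E i]%SET| <= c)%N) ->
  p * #|D|%:R <= c%:R.
Proof.
move=> mE pE cE.
(* The integral of the sum asks for measurability at every index, also outside [D]. *)
pose G i := if i \in D then E i else set0.
have mG i : measurable (G i) by rewrite /G; case: ifP => [/mE|].
have mG1 i : measurable_fun setT (EFin \o (\1_(G i) : T -> K)).
  exact/measurable_EFinP/measurable_indic.
have cG w : (\sum_(i <- enum D) (\1_(G i) w : K)%:E <= c%:R%:E)%E.
  rewrite sumEFin lee_fin big_enum /= (eq_bigr (fun i => (w \in E i)%:R)).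
    rewrite -natr_sum ler_nat; apply: leq_trans (cE w).
    rewrite -sum1_card big_mkcond [leqRHS]big_mkcond /=; apply: leq_sum => i _.
    by rewrite inE; case: (i \in D); case: (w \in E i).
  by move=> i iD; rewrite indicE /G iD.
have : (\int[P]_w (\sum_(i <- enum D) (\1_(G i) w : K)%:E) <= \int[P]_w c%:R%:E)%E.
  apply: ge0_le_integral => //.
  - by move=> w _; apply: sume_ge0 => i _; rewrite lee_fin.
  - exact: emeasurable_sum.
have -> : (\int[P]_w c%:R%:E = c%:R%:E :> \bar K)%E.
  by rewrite integral_cst// -[RHS]mule1; congr (_ * _)%E; exact: probability_setT.
rewrite ge0_integral_sum//.
rewrite -lee_fin; apply: le_trans.
rewrite mulr_natr -sumr_const -sumEFin big_enum /=; apply: lee_sum => i iD.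
by rewrite integral_indic// setIT /G iD pE.
Qed.

Lemma probability_setI_ge (d : measure_display) (T : measurableType d)
    (P : probability T K)
    (A B : set T) (p q : K) : measurable A -> measurable B ->
  ((1 - p)%:E <= P A)%E -> ((1 - q)%:E <= P B)%E ->
  ((1 - (p + q))%:E <= P (A `&` B)%classic)%E.
Proof.
move=> mA mB.
have mI := measurableI _ _ mA mB.
have : (P (~` (A `&` B)) <= P (~` A) + P (~` B))%classic%E.
  by rewrite setCI; exact: measureU2 (measurableC mA) (measurableC mB).
rewrite !probability_setC//.
have [fA fB fI] : [/\ P A \is a fin_num, P B \is a fin_num &
    P (A `&` B)%classic \is a fin_num].
  by split; exact: fin_num_measure.
rewrite -(fineK fA) -(fineK fB) -(fineK fI) -!EFinB -EFinD !lee_fin; lra.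
Qed.

End Algorithms.

(** * Choice of parameters and averaging over the planted set *)

Theorem theorem3 (R : realType) (kappa eps : R) (hkappa : 0 < kappa <= 1)
    (heps : 0 < eps) :
  ~ exists A : randomized_algorithm R,
      polynomially_many_queries kappa A /\
      approximates_whp kappa A (approx_factor kappa eps).
Proof.
case=> A [[q qA] wA].
(* Two events failing with probability at most 1/4 each still meet with probability at least 1/2. *)
have d4 : (0 : R) < 4^-1 by rewrite invr_gt0.
have [N1 _ HN1] := wA _ d4.
have [m meps] : exists m : nat, 1 <= (2 * m.+1)%:R * eps.
  exists (Num.bound eps^-1); rewrite -ler_pdivrMr// div1r.
  have ei : 0 <= eps^-1 by rewrite invr_ge0 ltW.
  by rewrite (le_trans (ltW (archi_boundP ei)))// ler_nat; lia.
have [N2 HN2] := poly_expn_lt_exp2 q m.+1.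
pose b := (maxn N1 N2).+1; pose B := (2 * b.+1)%N.
pose a := (B ^ m * b.+1)%N; pose n := (B ^ (2 * m.+1))%N.
have B0 : (0 < B)%N by [].
have na : n = (4 * a ^ 2)%N.
  rewrite /n /a mulnS expnD (mulnC 2 m) expnM.
  by rewrite [in (B ^ 2)%N]/B !expnMn; lia.
have ba : (b < a)%N by rewrite /a leq_pmull// expn_gt0 B0.
have a0 : (0 < a)%N by lia.
have aV : (2 * a < #|'I_n|)%N by rewrite card_ord na; nia.
have nN1 : (N1 <= n)%N by nia.
have qn : (2 * q.[n] < 2 ^ b.+1)%N by apply: HN2; rewrite /b; lia.
pose F := @planted R 'I_n kappa a b.
have cF (S : {set 'I_n}) : (#|S| <= a)%N -> curvature_class kappa (F S).
  by move=> Sa; exact: planted_class.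
have gap (S : {set 'I_n}) g : #|S| = a ->
    approximates (approx_factor kappa eps n) (F finset.set0) g ->
    ~ approximates (approx_factor kappa eps n) (F S) g.
  move=> Sa; apply: planted_gap => //; first exact: ltnW.
    by rewrite powR_gt0// ltr0n expn_gt0 B0.
  (* The exponent of [B] in [n ^ (1/2 - eps)] is [m + 1 - (2m + 2) eps], at most [m]; strictness
     comes from [b < b.+1]. *)
  apply: (@le_lt_trans _ _ (B%:R ^+ m * b%:R)).
    rewrite ler_wpM2r// /n natrX -powR_mulrn// -powRrM -powR_mulrn// ler_powR ?ler1n//.
    rewrite mulrBr natrM mulrAC divff// mul1r -natr1.
    by move: meps; rewrite natrM -natr1; lra.
  by rewrite /a natrM natrX ltr_pM2l ?ltr_nat// exprn_gt0// ltr0n.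
have cF0 : curvature_class kappa (F finset.set0) by apply: cF; rewrite cards0.
have [E0 [mE0 PE0 HE0]] := HN1 n nN1 _ cF0.
pose D := [set S : {set 'I_n} | #|S| == a]%SET.
have /choice[E HE] : forall S : {set 'I_n}, exists E : set (seed A), S \in D ->
    [/\ measurable E, ((1 - 4^-1)%:E <= seed_law A E)%E
      & forall w, E w -> approximates (approx_factor kappa eps n) (F S)
          (run (F S) (strategy A n w))].
  move=> S; have [/eqP Sa|Sa] := boolP (#|S| == a); last first.
    by exists set0; rewrite inE (negbTE Sa).
  have [E HE] := HN1 n nN1 _ (cF S (eq_leq Sa)).
  by exists E.
pose M := ('C(2 * a, b.+1) * 'C(#|'I_n| - b.+1, a - b.+1))%N.
(* For a seed in both [E0] and [E S], equal outputs would contradict [gap], so [S] is one of the at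
   most [q.[n] * M] sets that change the output. *)
have : (1 - (4^-1 + 4^-1)) * #|D|%:R <= (q.[n] * M)%N%:R :> R.
  apply: (@expected_count_le R _ (seed A) (seed_law A) _ D (fun S => E0 `&` E S)%classic).
  - by move=> S /HE[mE _ _]; exact: measurableI.
  - by move=> S /HE[mE PE _]; exact: probability_setI_ge.
  - move=> w; have := @run_diff_count R 'I_n _ D F (F finset.set0) M (strategy A n w).
    have q0 : (num_queries (F finset.set0) (strategy A n w) <= q.[n])%N by exact: qA.
    have FM Q : (#|[set S in D | F S Q != F finset.set0 Q]%SET| <= M)%N.
      apply: leq_trans (@planted_diff_count R 'I_n kappa a b Q ba).
      by apply: subset_leq_card; apply/fintype.subsetP => S; rewrite !inE.
    move=> /(_ FM) H; apply: leq_trans (leq_trans H _); last by rewrite leq_mul2r q0 orbT.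
    apply/subset_leq_card/fintype.subsetP => S; rewrite !inE => /andP[Sa].
    rewrite Sa inE => -[E0w ESw]; apply/asboolP => runE.
    have SD : S \in D by rewrite inE.
    have [_ _ HS] := HE S SD.
    have := gap S _ (eqP Sa) (HE0 w E0w); apply; rewrite -runE; exact: HS.
have := bin_halving _ _ ba.
rewrite -na /D card_draws /M card_ord => H1 H2.
have n0 : (0 < 'C(n, a))%N 
  by rewrite bin_gt0 -(card_ord n) (leq_trans _ (ltnW aV))// leq_pmull.
set M' := (_ * 'C(n - _, _))%N in H1 H2.
(* This contradicts [H2], by which half of all [a]-subsets change the output. If [M'] vanishes,
   multiplying [qn] by it is not strict, and [n0] is used instead. *)
have H3 : (2 * (q.[n] * M') < 'C(n, a))%N.
  rewrite mulnA; case: (posnP M') => [->|M0]; first by rewrite muln0.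
  by apply: leq_trans H1; rewrite ltn_pmul2r.
move: H3; rewrite -(ltr_nat R) natrM; move: H2.
move: (q.[n] * M')%N 'C(n, a) => k l; lra.
Qed.
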